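(* Let $\mathcal L$ be a semilattice and $(A_i)_{i\in\mathcal L}$ a family of $C^*$-algebras. (1) Suppose given, for all $i,j\in\mathcal L$ with $i\le j$, morphisms $\varphi_{i,j}:A_j\to M(A_i)$ satisfying conditions (a) and (b) below. For $i,j\in\mathcal L$ let $q_{i,j}:A_i\times A_j\to A_{i\wedge j}$ be the map $(x,y)\mapsto \varphi_{i\wedge j,i}(x)\varphi_{i\wedge j,j}(y)$. Then the family of maps $q_{i,j}$ satisfies conditions (a'), (b'), (c') below. (2) Conversely, suppose given, for all $i,j\in\mathcal L$, bilinear maps $q_{i,j}:A_i\times A_j\to A_{i\wedge j}$ satisfying conditions (a'), (b'), (c'). For $i,j\in\mathcal L$ with $i\le j$ there is a morphism $\varphi_{i,j}:A_j\to M(A_i)$ given by $\varphi_{i,j}(y)x=q_{j,i}(y,x)$ and $x\varphi_{i,j}(y)=q_{i,j}(x,y)$ for $x\in A_i$, $y\in A_j$. The family of morphisms $\varphi_{i,j}$ satisfies conditions (a) and (b). Here the conditions are: (a) $\varphi_{i,i}=\mathrm{Id}_{A_i}$ (the canonical inclusion $A_i\subset M(A_i)$) for all $i\in\mathcal L$; (b) for all $i,j\in\mathcal L$, with $k=i\wedge j$, all $m\le k$ and all $x\in A_i$, $y\in A_j$: $\varphi_{k,i}(x)\varphi_{k,j}(y)\in A_k$ and $\varphi_{m,k}(\varphi_{k,i}(x)\varphi_{k,j}(y))=\varphi_{m,i}(x)\varphi_{m,j}(y)$; (a') $q_{i,i}(x,y)=xy$ for all $i\in\mathcal L$ and $x,y\in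 A_i$; (b') $q_{i,j}(x,y)=q_{j,i}(y^*,x^* )^*$ for all $i,j\in\mathcal L$, $x\in A_i$, $y\in A_j$; (c') $q_{i\wedge j,k}(q_{i,j}(x,y),z)=q_{i,j\wedge k}(x,q_{j,k}(y,z))$ for all $i,j,k\in\mathcal L$, $x\in A_i$, $y\in A_j$, $z\in A_k$.
   Context: A semilattice is a partially ordered set $\mathcal L$ in which any two elements $k,\ell$ have a greatest lower bound $k\wedge\ell$. $M(A)$ denotes the multiplier algebra of a $C^*$-algebra $A$; $A$ is identified with its canonical image in $M(A)$. Morphisms of $C^*$-algebras are $*$-homomorphisms. *)

(* Defs.v *)
From HB Require Import structures.
From mathcomp Require Import all_boot all_order all_algebra.
From mathcomp Require Import sesquilinear complex.
From mathcomp Require Import boolp classical_sets reals topology normedtype.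

Set Implicit Arguments.
Unset Strict Implicit.
Unset Printing Implicit Defensive.

Import Order.TTheory GRing.Theory Num.Theory.
Local Open Scope ring_scope.

Reserved Notation "x ** y" (at level 40, left associativity).

(* MathComp rings all have a unit, whereas C*-algebras need not; hence this
   separate structure of associative, not necessarily unital *-algebras. *)
HB.mixin Record isStarAlgebra (C : numClosedFieldType) A
    of GRing.Lmodule C A := {
  smul : A -> A -> A;
  star : A -> A;
  smulA : associative smul;
  smulDl : left_distributive smul +%R;
  smulDr : right_distributive smul +%R;
  smulZl : forall (c : C) (x y : A), smul (c *: x) y = c *: smul x y;
  smulZr : forall (c : C) (x y : A), smul x (c *: y) = c *: smul x y;
  starK : involutive star;
  starD : {morph star : x y / x + y};
  starZ : forall (c : C) (x : A), star (c *: x) = Num.conj c *: star x;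
  starM : forall x y : A, star (smul x y) = smul (star y) (star x)
}.

#[short(type="starAlgType")]
HB.structure Definition StarAlgebra (C : numClosedFieldType) :=
  {A of isStarAlgebra C A & GRing.Lmodule C A}.

Notation "x ** y" := (smul x y) : ring_scope.

HB.mixin Record isCStarAlgebra (R : realType) A
    of StarAlgebra R[i] A & CompleteNormedModule R[i] A := {
  cstar_normM : forall x y : A, `|x ** y| <= `|x| * `|y|;
  cstar_identity : forall x : A, `|star x ** x| = `|x| ^+ 2
}.

#[short(type="cstarAlgType")]
HB.structure Definition CStarAlgebra (R : realType) :=
  {A of isCStarAlgebra R A & StarAlgebra R[i] A & CompleteNormedModule R[i] A}.

HB.mixin Record isStarHom (C : numClosedFieldType) (A B : starAlgType C)
    (f : A -> B) := {
  starHomM : {morph f : x y / x ** y};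
  starHom_star : {morph f : x / star x}
}.

#[short(type="starHom")]
HB.structure Definition StarHom (C : numClosedFieldType) (A B : starAlgType C) :=
  {f of isStarHom C A B f & @GRing.Linear C A B *:%R f}.

Section CStarTheory.
Variables (R : realType) (A : cstarAlgType R).
Implicit Types x y z : A.

Lemma smul0r x : x ** 0 = 0.
Proof. by rewrite -(scale0r (0 : A)) smulZr !scale0r. Qed.

Lemma smul0l x : 0 ** x = 0.
Proof. by rewrite -(scale0r (0 : A)) smulZl !scale0r. Qed.

Lemma smulNr x y : x ** (- y) = - (x ** y).
Proof. by rewrite -scaleN1r smulZr scaleN1r. Qed.

Lemma smulNl x y : (- x) ** y = - (x ** y).
Proof. by rewrite -scaleN1r smulZl scaleN1r. Qed.

Lemma smul_eq0 z : star z ** z = 0 -> z = 0.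
Proof.
move=> zz; apply/eqP; rewrite -normr_eq0 -sqrf_eq0.
by rewrite -cstar_identity zz normr0.
Qed.

Lemma smulIl y z : (forall x, x ** y = x ** z) -> y = z.
Proof.
move=> yz; apply/eqP; rewrite -subr_eq0; apply/eqP/smul_eq0.
by rewrite smulDr smulNr yz subrr.
Qed.

Lemma smulIr y z : (forall x, y ** x = z ** x) -> y = z.
Proof.
move=> yz; apply: (can_inj (@starK _ A)); apply: smulIl => x.
by rewrite -[x]starK -!starM yz.
Qed.

End CStarTheory.

(* M(A) is the *-algebra of double centralizers of A: m stands for the pair of
   maps x |-> m x and x |-> x m.  Since A is a C*-algebra, both maps are
   automatically linear (proved below) and bounded. *)
Record multiplier (R : realType) (A : cstarAlgType R) := Multiplier {
  lmult : A -> A;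
  rmult : A -> A;
  multP : forall x y : A, x ** lmult y = rmult x ** y
}.
Arguments Multiplier {R A}.

Section Multiplier.
Variables (R : realType) (A : cstarAlgType R).
Local Notation M := (multiplier A).
Implicit Types (m n p : M) (x y z : A) (c : R[i]).

Lemma multiplier_ext m n : lmult m =1 lmult n -> rmult m =1 rmult n -> m = n.
Proof.
case: m n => [l r P] [l' r' P'] /= /funext el /funext er.
by subst l' r'; congr Multiplier; exact: Prop_irrelevance.
Qed.

Lemma lmultD m x y : lmult m (x + y) = lmult m x + lmult m y.
Proof. by apply: smulIl => z; rewrite smulDr !multP smulDr. Qed.

Lemma lmultZ m c x : lmult m (c *: x) = c *: lmult m x.
Proof. by apply: smulIl => z; rewrite smulZr !multP smulZr. Qed.

Lemma rmultD m x y : rmult m (x + y) = rmult m x + rmult m y.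
Proof. by apply: smulIr => z; rewrite smulDl -!multP smulDl. Qed.

Lemma rmultZ m c x : rmult m (c *: x) = c *: rmult m x.
Proof. by apply: smulIr => z; rewrite smulZl -!multP smulZl. Qed.

Definition mult_zero : M.
Proof.
by exists (fun=> 0) (fun=> 0) => x y; rewrite smul0r smul0l.
Defined.

Definition mult_opp m : M.
Proof.
exists (fun x => - lmult m x) (fun x => - rmult m x) => x y.
by rewrite smulNr smulNl multP.
Defined.

Definition mult_add m n : M.
Proof.
exists (fun x => lmult m x + lmult n x) (fun x => rmult m x + rmult n x) => x y.
by rewrite smulDr smulDl !multP.
Defined.

Definition mult_scale c m : M.
Proof.
exists (fun x => c *: lmult m x) (fun x => c *: rmult m x) => x y.
by rewrite smulZr smulZl multP.
Defined.

Definition mult_mul m n : M.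
Proof.
exists (fun x => lmult m (lmult n x)) (fun x => rmult n (rmult m x)) => x y.
by rewrite !multP.
Defined.

Definition mult_star m : M.
Proof.
exists (fun x => star (rmult m (star x))) (fun x => star (lmult m (star x))).
by move=> x y; apply: (can_inj (@starK _ A)); rewrite !starM !starK multP.
Defined.

HB.instance Definition _ := gen_eqMixin M.
HB.instance Definition _ := gen_choiceMixin M.

Fact mult_addA : associative mult_add.
Proof. by move=> m n p; apply: multiplier_ext => x /=; rewrite addrA. Qed.

Fact mult_addC : commutative mult_add.
Proof. by move=> m n; apply: multiplier_ext => x /=; rewrite addrC. Qed.

Fact mult_add0 : left_id mult_zero mult_add.
Proof. by move=> m; apply: multiplier_ext => x /=; rewrite add0r. Qed.

Fact mult_addN : left_inverse mult_zero mult_opp mult_add.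
Proof. by move=> m; apply: multiplier_ext => x /=; rewrite addNr. Qed.

HB.instance Definition _ :=
  GRing.isZmodule.Build M mult_addA mult_addC mult_add0 mult_addN.

Fact mult_scaleA c d m : mult_scale c (mult_scale d m) = mult_scale (c * d) m.
Proof. by apply: multiplier_ext => x /=; rewrite scalerA. Qed.

Fact mult_scale1 : left_id 1 mult_scale.
Proof. by move=> m; apply: multiplier_ext => x /=; rewrite scale1r. Qed.

Fact mult_scaleDr : right_distributive mult_scale +%R.
Proof. by move=> c m n; apply: multiplier_ext => x /=; rewrite scalerDr. Qed.

Fact mult_scaleDl m : {morph mult_scale^~ m : c d / c + d}.
Proof. by move=> c d; apply: multiplier_ext => x /=; rewrite scalerDl. Qed.

HB.instance Definition _ := GRing.Zmodule_isLmodule.Build R[i] M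
  mult_scaleA mult_scale1 mult_scaleDr mult_scaleDl.

Fact mult_mulA : associative mult_mul.
Proof. by move=> m n p; apply: multiplier_ext. Qed.

Fact mult_mulDl : left_distributive mult_mul +%R.
Proof. by move=> m n p; apply: multiplier_ext => x //=; rewrite rmultD. Qed.

Fact mult_mulDr : right_distributive mult_mul +%R.
Proof. by move=> m n p; apply: multiplier_ext => x //=; rewrite lmultD. Qed.

Fact mult_mulZl c m n : mult_mul (c *: m) n = c *: mult_mul m n.
Proof. by apply: multiplier_ext => x //=; rewrite rmultZ. Qed.

Fact mult_mulZr c m n : mult_mul m (c *: n) = c *: mult_mul m n.
Proof. by apply: multiplier_ext => x //=; rewrite lmultZ. Qed.

Fact mult_starK : involutive mult_star.
Proof. by move=> m; apply: multiplier_ext => x /=; rewrite !starK. Qed.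

Fact mult_starD : {morph mult_star : m n / m + n}.
Proof. by move=> m n; apply: multiplier_ext => x /=; rewrite starD. Qed.

Fact mult_starZ c m : mult_star (c *: m) = Num.conj c *: mult_star m.
Proof. by apply: multiplier_ext => x /=; rewrite starZ. Qed.

Fact mult_starM m n :
  mult_star (mult_mul m n) = mult_mul (mult_star n) (mult_star m).
Proof. by apply: multiplier_ext => x /=; rewrite !starK. Qed.

HB.instance Definition _ := isStarAlgebra.Build R[i] M
  mult_mulA mult_mulDl mult_mulDr mult_mulZl mult_mulZr
  mult_starK mult_starD mult_starZ mult_starM.

(* A is identified with its image under this injective *-homomorphism. *)
Definition in_mult (a : A) : M.
Proof. by exists (smul a) (smul^~ a) => x y; rewrite smulA. Defined.

Lemma in_mult_inj : injective in_mult.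
Proof. by move=> a b [] eab _; apply: smulIr => x; rewrite eab. Qed.

Fact in_mult_is_linear : linear in_mult.
Proof.
move=> c a b; apply: multiplier_ext => x /=.
  by rewrite smulDl smulZl.
by rewrite smulDr smulZr.
Qed.

HB.instance Definition _ :=
  GRing.isLinear.Build R[i] A M *:%R in_mult in_mult_is_linear.

Fact in_multM : {morph in_mult : a b / a ** b}.
Proof. by move=> a b; apply: multiplier_ext => x /=; rewrite smulA. Qed.

Fact in_mult_star : {morph in_mult : a / star a}.
Proof. by move=> a; apply: multiplier_ext => x /=; rewrite starM starK. Qed.

HB.instance Definition _ := isStarHom.Build R[i] A M in_mult
  in_multM in_mult_star.

Lemma mul_in_mult m x : m ** in_mult x = in_mult (lmult m x).
Proof.
apply: multiplier_ext => y /=; last by rewrite multP.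
by apply: smulIl => z; rewrite multP !smulA multP.
Qed.

Lemma in_mult_mul m x : in_mult x ** m = in_mult (rmult m x).
Proof.
apply: multiplier_ext => y /=; first by rewrite multP.
by apply: smulIr => z; rewrite -multP -!smulA multP.
Qed.

End Multiplier.

Section Families.
Context {R : realType} {d : Order.disp_t} {L : meetSemilatticeType d}.
Variable A : L -> cstarAlgType R.

Definition mult_family :=
  forall i j : L, (i <= j)%O -> starHom (A j) (multiplier (A i)).

Definition prod_family := forall i j : L, A i -> A j -> A (i `&` j)%O.

Definition bilinear_family :=
  forall i j : L, {bilinear A i -> A j -> A (i `&` j)%O}.

Definition prod_of_bilinear (q : bilinear_family) : prod_family :=
  fun i j x y => q i j x y.

Definition cond_a (phi : mult_family) :=
  forall (i : L) (x : A i), phi i i (lexx i) x = in_mult x.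

(* The witness z is the product phi_{k,i}(x) phi_{k,j}(y), viewed in A_k. *)
Definition cond_b (phi : mult_family) :=
  forall (i j : L) (x : A i) (y : A j),
  exists2 z : A (i `&` j)%O,
    in_mult z = phi _ i (leIl i j) x ** phi _ j (leIr j i) y &
    forall (m : L) (hm : (m <= i `&` j)%O),
      phi m _ hm z = phi m i (le_trans hm (leIl i j)) x **
                     phi m j (le_trans hm (leIr j i)) y.

(* Both sides of the following identities live in fibres over provably, but not
   definitionally, equal indices; ecast transports along these equalities. *)
Definition cond_a' (q : prod_family) :=
  forall (i : L) (x y : A i),
    ecast k (A k) (meetxx i) (q i i x y) = x ** y.

Definition cond_b' (q : prod_family) :=
  forall (i j : L) (x : A i) (y : A j),
    q i j x y = ecast k (A k) (meetC j i) (star (q j i (star y) (star x))).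

Definition cond_c' (q : prod_family) :=
  forall (i j k : L) (x : A i) (y : A j) (z : A k),
    q (i `&` j)%O k (q i j x y) z =
    ecast l (A l) (meetA i j k) (q i (j `&` k)%O x (q j k y z)).

Definition is_product_family (phi : mult_family) (q : prod_family) :=
  forall (i j : L) (x : A i) (y : A j),
    in_mult (q i j x y) = phi _ i (leIl i j) x ** phi _ j (leIr j i) y.

Definition is_mult_family (q : prod_family) (phi : mult_family) :=
  forall (i j : L) (hij : (i <= j)%O) (x : A i) (y : A j),
    phi i j hij y ** in_mult x =
      in_mult (ecast k (A k) (meet_r hij) (q j i y x)) /\
    in_mult x ** phi i j hij y =
      in_mult (ecast k (A k) (meet_l hij) (q i j x y)).

End Families.

(* Main.v *)
Require Import Defs.
From HB Require Import structures.
From mathcomp Require Import all_boot all_order all_algebra.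
From mathcomp Require Import sesquilinear complex.
From mathcomp Require Import boolp classical_sets reals topology normedtype.

(** The two halves rest on one observation each.

    From morphisms to products: since each A_k embeds in its multiplier
    algebra, an identity between elements of A_k may be checked in M(A_k).
    There every q-expression becomes a plain product of images of its
    arguments: a single application of q by definition, a nested one because
    condition (b) says how phi acts on such products.  Then (a'), (b'), (c')
    reduce to (a), to phi preserving the involution, and to associativity in
    M(A_k) (lemmas [product_family_idem], [product_family_star] and
    [product_family_assoc]).

    From products to morphisms: the maps q_{i,j} together form one binary
    operation [total_mul] on the disjoint union of the A_i.  Conditions (b')
    and (c') say that this union is a semigroup with involution, and (a') that
    the operation extends the product of each A_i.  If i <= j then
    i /\ j = i, so A_j acts on A_i from both sides inside this semigroup.
    By associativity and the rules for the involution, the actions are double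
    centralizers depending *-multiplicatively on the element of A_j
    ([fibre_action_starHom]).  The same associativity gives (b): multiplying
    by q_{i,j}(x,y) amounts to multiplying by y and by x in succession
    ([mult_family_prod]). *)

Set Implicit Arguments.
Unset Strict Implicit.
Unset Printing Implicit Defensive.

Import Order.TTheory GRing.Theory Num.Theory.
Local Open Scope ring_scope.

(** * Transport between fibres *)

Section Fibres.
Context {R : realType} {d : Order.disp_t} {L : meetSemilatticeType d}.
Variable A : L -> cstarAlgType R.

Lemma Tagged_ecast (k l : L) (e : k = l) (z : A k) :
  Tagged A (ecast k (A k) e z) = Tagged A z.
Proof. by case: l / e. Qed.

Lemma ecast_is_linear (k l : L) (e : k = l) :
  linear (fun z : A k => ecast k (A k) e z).
Proof. by case: l / e. Qed.

Lemma Tagged_inj (k : L) : injective (fun z : A k => Tagged A z).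
Proof. by move=> x y /eqP; rewrite eq_Tagged => /eqP. Qed.

(** A multiplier cannot be compared directly with one over an equal index.
    Here P gives an expression that makes sense over every index below n, so
    that it can be read both before and after the transport. *)
Lemma in_mult_ecast (n : L) (P : forall k, (k <= n)%O -> multiplier (A k))
    (k l : L) (e : k = l) (hk : (k <= n)%O) (hl : (l <= n)%O) (z : A k) :
  in_mult z = P k hk -> in_mult (ecast k (A k) e z) = P l hl.
Proof. by case: l / e hl => hl ->; rewrite (bool_irrelevance hk hl). Qed.

End Fibres.

(** * From morphisms to products *)

Section ProductsOfMorphisms.
Context {R : realType} {d : Order.disp_t} {L : meetSemilatticeType d}.
Variables (A : L -> cstarAlgType R) (phi : mult_family A) (q : prod_family A).
Hypothesis phi_q : is_product_family phi q.

Lemma product_family_idem : cond_a phi -> cond_a' q.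
Proof.
move=> phi_a i x y; apply: (@in_mult_inj R (A i)).
rewrite in_multM -(phi_a _ x) -(phi_a _ y).
have hi : (i <= i `&` i)%O by rewrite meetxx.
rewrite (in_mult_ecast (n := (i `&` i)%O)
  (P := fun m hm => phi (le_trans hm (leIl i i)) x **
                    phi (le_trans hm (leIr i i)) y)
  (meetxx i) (hk := lexx _) hi).
  by congr (phi _ x ** phi _ y); exact: bool_irrelevance.
by rewrite phi_q; congr (phi _ x ** phi _ y); exact: bool_irrelevance.
Qed.

Lemma product_family_star : cond_b' q.
Proof.
move=> i j x y; apply: (@in_mult_inj R (A (i `&` j)%O)).
have hji : (i `&` j <= j `&` i)%O by rewrite meetC.
rewrite (in_mult_ecast (n := (j `&` i)%O)
  (P := fun m hm => phi (le_trans hm (leIr i j)) x **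
                    phi (le_trans hm (leIl j i)) y)
  (meetC j i) (hk := lexx _) hji).
  rewrite phi_q.
  by congr (phi _ x ** phi _ y); exact: bool_irrelevance.
rewrite in_mult_star phi_q starM -!starHom_star !starK.
by congr (phi _ x ** phi _ y); exact: bool_irrelevance.
Qed.

(** By injectivity of [in_mult], the witness in condition (b) is the value
    of q, which makes the second half of (b) a formula for phi on it. *)
Lemma phi_product_family (phi_b : cond_b phi) (i j m : L) (x : A i) (y : A j)
    (hm : (m <= i `&` j)%O) (hi : (m <= i)%O) (hj : (m <= j)%O) :
  phi hm (q x y) = phi hi x ** phi hj y.
Proof.
have [z zE phi_z] := phi_b i j x y.
have -> : q x y = z by apply: (@in_mult_inj R (A _)); rewrite zE phi_q.
by rewrite phi_z; congr (phi _ x ** phi _ y); exact: bool_irrelevance.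
Qed.

(** By condition (b), both bracketings become the product of the images of x,
    y and z in the multiplier algebra over the threefold meet. *)
Lemma product_family_assoc : cond_b phi -> cond_c' q.
Proof.
move=> phi_b i j k x y z; apply: (@in_mult_inj R (A ((i `&` j) `&` k)%O)).
have hi m : (m <= i `&` (j `&` k))%O -> (m <= i)%O by rewrite lexI => /andP[].
have hj m : (m <= i `&` (j `&` k))%O -> (m <= j)%O.
  by rewrite !lexI => /and3P[].
have hk m : (m <= i `&` (j `&` k))%O -> (m <= k)%O.
  by rewrite !lexI => /and3P[].
have hijk : ((i `&` j) `&` k <= i `&` (j `&` k))%O by rewrite meetA.
rewrite (in_mult_ecast (n := (i `&` (j `&` k))%O)
  (P := fun m hm => phi (hi m hm) x **
                    (phi (hj m hm) y ** phi (hk m hm) z))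
  (meetA i j k) (hk := lexx _) hijk).
  rewrite phi_q (phi_product_family phi_b _ _ _ (hi _ hijk) (hj _ hijk)).
  rewrite -smulA.
  by congr (_ ** (_ ** phi _ z)); exact: bool_irrelevance.
rewrite phi_q (phi_product_family phi_b _ _ _ (hj _ (lexx _)) (hk _ (lexx _))).
by congr (phi _ x ** _); exact: bool_irrelevance.
Qed.

End ProductsOfMorphisms.

(** * From products to morphisms *)

Section MorphismsOfProducts.
Context {R : realType} {d : Order.disp_t} {L : meetSemilatticeType d}.
Variables (A : L -> cstarAlgType R) (q : bilinear_family A).
Local Notation qp := (prod_of_bilinear q).
Local Notation total := {i : L & A i}.
Local Notation "[ x ]" := (Tagged A x).

(** On the disjoint union of the fibres the transports become identities
    ([Tagged_ecast]), so the conditions on q turn into plain equations. *)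
Definition total_mul (u v : total) : total :=
  [q (tag u) (tag v) (tagged u) (tagged v)].

Definition total_star (u : total) : total := [star (tagged u)].

Local Infix "\*" := total_mul (at level 40, left associativity).

Hypotheses (q_idem : cond_a' qp) (q_star : cond_b' qp) (q_assoc : cond_c' qp).

Lemma total_mulE (i : L) (x y : A i) : [x] \* [y] = [x ** y].
Proof. by rewrite -(q_idem x y) Tagged_ecast. Qed.

Lemma total_mulA : associative total_mul.
Proof.
move=> [i x] [j y] [k z]; rewrite /total_mul /=.
by have /= := q_assoc x y z; rewrite /prod_of_bilinear => ->; rewrite Tagged_ecast.
Qed.

Lemma total_starM (u v : total) :
  total_star (u \* v) = total_star v \* total_star u.
Proof.
case: u v => [i x] [j y]; rewrite /total_mul /total_star /=.
have := q_star (star y) (star x); rewrite /prod_of_bilinear !starK => ->.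
by rewrite Tagged_ecast.
Qed.

Section Action.
Variables (i j : L) (hij : (i <= j)%O).

Definition left_action (y : A j) (x : A i) : A i :=
  ecast k (A k) (meet_r hij) (q j i y x).

Definition right_action (y : A j) (x : A i) : A i :=
  ecast k (A k) (meet_l hij) (q i j x y).

Lemma Tagged_left_action y x : [left_action y x] = [y] \* [x].
Proof. exact: Tagged_ecast. Qed.

Lemma Tagged_right_action y x : [right_action y x] = [x] \* [y].
Proof. exact: Tagged_ecast. Qed.

Lemma fibre_action_multP y x x' :
  x ** left_action y x' = right_action y x ** x'.
Proof.
apply: Tagged_inj; rewrite -!total_mulE Tagged_left_action Tagged_right_action.
exact: total_mulA.
Qed.

Definition fibre_action (y : A j) : multiplier (A i) :=
  Multiplier (left_action y) (right_action y) (fibre_action_multP y).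

Lemma fibre_action_is_linear : linear fibre_action.
Proof.
move=> c y y'; apply: multiplier_ext => x /=.
  by rewrite /left_action linearPl ecast_is_linear.
by rewrite /right_action linearPr ecast_is_linear.
Qed.

Lemma fibre_actionM : {morph fibre_action : y y' / y ** y'}.
Proof.
move=> y y'; apply: multiplier_ext => x /=; apply: Tagged_inj.
  by rewrite !Tagged_left_action -total_mulE total_mulA.
by rewrite !Tagged_right_action -total_mulE total_mulA.
Qed.

Lemma fibre_action_star : {morph fibre_action : y / star y}.
Proof.
move=> y; apply: multiplier_ext => x /=; apply: Tagged_inj.
  rewrite Tagged_left_action -[LHS]/(total_star [y] \* [x]).
  rewrite -[RHS]/(total_star [right_action y (star x)]) Tagged_right_action.
  by rewrite total_starM /total_star /= starK.
rewrite Tagged_right_action -[LHS]/([x] \* total_star [y]).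
rewrite -[RHS]/(total_star [left_action y (star x)]) Tagged_left_action.
by rewrite total_starM /total_star /= starK.
Qed.

HB.instance Definition _ := GRing.isLinear.Build R[i] (A j) (multiplier (A i))
  *:%R fibre_action fibre_action_is_linear.

HB.instance Definition _ := isStarHom.Build R[i] (A j) (multiplier (A i))
  fibre_action fibre_actionM fibre_action_star.

Definition fibre_action_starHom : starHom (A j) (multiplier (A i)) :=
  fibre_action.

End Action.

Lemma fibre_action_mult_family : is_mult_family qp fibre_action_starHom.
Proof. by move=> i j hij x y; rewrite mul_in_mult in_mult_mul. Qed.

Section Characterization.
Variable phi : mult_family A.
Hypothesis phi_q : is_mult_family qp phi.

Lemma Tagged_lmult (i j : L) (hij : (i <= j)%O) (x : A i) (y : A j) :
  [lmult (phi hij y) x] = [y] \* [x].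
Proof.
have [+ _] := phi_q hij x y; rewrite mul_in_mult => /(@in_mult_inj R (A i)) ->.
exact: Tagged_ecast.
Qed.

Lemma Tagged_rmult (i j : L) (hij : (i <= j)%O) (x : A i) (y : A j) :
  [rmult (phi hij y) x] = [x] \* [y].
Proof.
have [_ +] := phi_q hij x y; rewrite in_mult_mul => /(@in_mult_inj R (A i)) ->.
exact: Tagged_ecast.
Qed.

Lemma mult_family_idem : cond_a phi.
Proof.
move=> i x; apply: multiplier_ext => y /=; apply: Tagged_inj.
  by rewrite Tagged_lmult total_mulE.
by rewrite Tagged_rmult total_mulE.
Qed.

(** Associativity of the total product: [q i j x y] acts as y followed by x
    on the left, and as x followed by y on the right. *)
Lemma mult_family_prod (i j m : L) (x : A i) (y : A j)
    (hm : (m <= i `&` j)%O) (hi : (m <= i)%O) (hj : (m <= j)%O) :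
  phi hm (q i j x y) = phi hi x ** phi hj y.
Proof.
apply: multiplier_ext => t /=; apply: Tagged_inj.
  by rewrite !Tagged_lmult total_mulA.
by rewrite !Tagged_rmult -total_mulA.
Qed.

Lemma mult_family_cond_b : cond_b phi.
Proof.
move=> i j x y; exists (q i j x y) => [|m hm]; last exact: mult_family_prod.
by rewrite -mult_family_idem; exact: mult_family_prod.
Qed.

End Characterization.

End MorphismsOfProducts.

Theorem proposition3p1p1 (R : realType) (d : Order.disp_t)
    (L : meetSemilatticeType d) (A : L -> cstarAlgType R) :
  (forall phi : mult_family A, cond_a phi -> cond_b phi ->
     (exists q : prod_family A, is_product_family phi q) /\
     (forall q : prod_family A, is_product_family phi q ->
        cond_a' q /\ cond_b' q /\ cond_c' q)) /\
  (forall q : bilinear_family A,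
     cond_a' (prod_of_bilinear q) ->
     cond_b' (prod_of_bilinear q) ->
     cond_c' (prod_of_bilinear q) ->
     (exists phi : mult_family A, is_mult_family (prod_of_bilinear q) phi) /\
     (forall phi : mult_family A, is_mult_family (prod_of_bilinear q) phi ->
        cond_a phi /\ cond_b phi)).
Proof.
split=> [phi phi_a phi_b | q q_idem q_star q_assoc].
  split=> [|q phi_q].
    exists (fun i j x y => s2val (cid2 (phi_b i j x y))) => i j x y.
    by case: cid2.
  split; first exact: product_family_idem phi_q phi_a.
  split; first exact: product_family_star phi_q.
  exact: product_family_assoc phi_q phi_b.
split=> [|phi phi_q].
  exists (fibre_action_starHom q_idem q_star q_assoc).
  exact: fibre_action_mult_family.
by split; [exact: mult_family_idem phi_q | exact: mult_family_cond_b phi_q].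
Qed.
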